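(* Let $\beta\in(0,n)$, $q>0$, $1\le p<n/\beta$ and $q_0>0$. Then the following statements are equivalent. 1. For all $f\in C_0^\infty(\mathbb{R}^n)$: $$\|f\|_{L^{\frac{np}{n-p\beta},q_0}(\mathbb{R}^n)}\lesssim\|f\|_{L^{p,q_0}(\mathbb{R}^n;C^{p,q}_\beta)}.$$ 2. For every bounded domain $O\subset\mathbb{R}^n$ with $C^\infty$ boundary: $$V(O)^{\frac{n-p\beta}{n}}\lesssim C^{p,q}_\beta(\overline{O}).$$ Moreover, when $q\ge p$, both (i) and (ii) hold.
   Context: $C_0^\infty(\mathbb{R}^n)$ is the space of compactly supported smooth functions, $V$ is Lebesgue measure on $\mathbb{R}^n$, and $1_E$ is the characteristic function of $E$. Implicit constants are independent of $f$ and $O$. Besov norm: let $k=1+\lfloor\beta\rfloor$, $\Delta^1_h f(x)=f(x+h)-f(x)$ and $\Delta^k_h=\Delta^1_h\Delta^{k-1}_h$. Then $$\|f\|_{\dot{\Lambda}^{p,q}_\beta(\mathbb{R}^n)}=\left(\int_{\mathbb{R}^n}\|\Delta^k_h f\|_{L^p}^q|h|^{-(n+\beta q)}dh\right)^{1/q}.$$ Besov capacity: for compact $K$, $$C^{p,q}_\beta(K)=\inf\{\|f\|^p_{\dot{\Lambda}^{p,q}_\beta}: f\in C_0^\infty(\mathbb{R}^n),\ f\ge 1_K\}.$$ For arbitrary $E$, $$C^{p,q}_\beta(E)=\inf_{O\supseteq E\text{ open}}\sup_{K\subseteq O\text{ compact}}C^{p,q}_\beta(K).$$ Lorentz quasinorms: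 for $\nu$ a measure or set function, and $O_t(g)=\{x:|g(x)|>t\}$, $$\|g\|_{L^{s,q_0}(\mathbb{R}^n;\nu)}=\left(\int_0^\infty\nu(O_t(g))^{q_0/s}\,d(t^{q_0})\right)^{1/q_0}.$$ When no $\nu$ is indicated, $\nu=V$. *)

(* Defs.v *)
From HB Require Import structures.
From mathcomp Require Import all_boot all_order all_algebra.
From mathcomp Require Import all_classical all_reals all_analysis.
Set Implicit Arguments.
Unset Strict Implicit.
Unset Printing Implicit Defensive.
Import Order.TTheory GRing.Theory Num.Theory numFieldNormedType.Exports.
Local Open Scope classical_set_scope.
Local Open Scope ring_scope.

(** * Outer measure generated by a set function on an arbitrary family of
    covering sets (copy of mathcomp's [mu_ext] construction, for a family
    [D] that need not be a semiring of sets). *)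
Section cover_outer_measure.
Local Open Scope ereal_scope.
Context (R : realType) (T : Type) (D : set (set T)) (mu : set T -> \bar R).
Hypotheses (D0 : D set0) (mu0 : mu set0 = 0) (mu_ge0 : forall X, 0 <= mu X).

Definition D_cover (X : set T) := [set F : (set T)^nat |
  (forall i, D (F i)) /\ X `<=` \bigcup_k (F k)].

Definition cover_ext (X : set T) : \bar R :=
  ereal_inf [set \sum_(k <oo) mu (A k) | A in D_cover X].

Lemma le_cover_ext : {homo cover_ext : A B / A `<=` B >-> A <= B}.
Proof.
move=> A B AB; apply/ereal_inf_le_tmp => x [B' [mB' BB']].
by move=> <-{x}; exists B' => //; split => //; apply: subset_trans AB BB'.
Qed.

Lemma cover_ext_ge0 A : 0 <= cover_ext A.
Proof.
apply: le_ereal_inf_tmp => x [B [mB AB] <-{x}]; rewrite lime_ge //=.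
  exact: is_cvg_nneseries.
by near=> k; rewrite sume_ge0.
Unshelve. all: by end_near. Qed.

Lemma cover_ext0 : cover_ext set0 = 0.
Proof.
apply/eqP; rewrite eq_le; apply/andP; split; last exact/cover_ext_ge0.
rewrite /cover_ext; apply: ereal_inf_lbound; exists (fun=> set0); first by split.
by apply: lim_near_cst => //; near=> k => /=; rewrite big1.
Unshelve. all: by end_near. Qed.

Lemma cover_ext_sigma_subadditive : sigma_subadditive cover_ext.
Proof.
move=> A; have [[i ioo]|] := pselect (exists i, cover_ext (A i) = +oo).
  rewrite (eseries_pinfty _ _ ioo) ?leey// => k _.
  by rewrite -ltNye (lt_le_trans _ (cover_ext_ge0 _)).
rewrite -forallNE => Aoo.
suff add2e (e : {posnum R}) :
    cover_ext (\bigcup_k A k) <= \sum_(i <oo) cover_ext (A i) + e%:num%:E.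
  by apply/lee_addgt0Pr => _/posnumP[].
rewrite (le_trans _ (epsilon_trick _ _ _))//; last first.
  by move=> k; exact: cover_ext_ge0.
pose P k (B : (set T)^nat) := D_cover (A k) B /\
  \sum_(j <oo) mu (B j) <= cover_ext (A k) + (e%:num / (2 ^ k.+1)%:R)%:E.
have [G PG] : {G : ((set T)^nat)^nat & forall k, P k (G k)}.
  apply: (@choice _ _ P) => k; rewrite /P /cover_ext.
  set S := (X in ereal_inf X); move infS : (ereal_inf S) => iS.
  case: iS infS => [r Sr|Soo|Soo].
  - have en1 : (0 < e%:num / (2 ^ k.+1)%:R)%R by [].
    have /(lb_ereal_inf_adherent en1) : ereal_inf S \is a fin_num by rewrite Sr.
    move=> [x [B [mB AnB muBx] xS]].
    by exists B; split => //; rewrite muBx -Sr; exact/ltW.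
  - by have := Aoo k; rewrite /cover_ext Soo.
  - suff : lbound S 0 by move/le_ereal_inf_tmp; rewrite Soo.
    by move=> /= _ [B [mB AnB] <-]; exact: nneseries_ge0.
have muG_ge0 x : 0 <= (mu \o uncurry G) x by exact: mu_ge0.
apply: (@le_trans _ _ (\esum_(i in setT) (mu \o uncurry G) i)).
  rewrite /cover_ext; apply: ereal_inf_lbound => /=.
  have /card_esym/ppcard_eqP[f] := card_nat2.
  exists (uncurry G \o f).
    split => [i|]; first by rewrite /=; case: (f i) => a b; move: (PG a) => [[+ _] _]; apply.
    apply: (@subset_trans _  (\bigcup_k \bigcup_j G k j)) => [t [i _]|].
      by move=> /((PG i).1.2) -[j _ ?]; exists i => //; exists j.
    move=> t [i _ [j _ Bijt]]; exists (f^-1%FUN (i, j)) => //=.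
    by rewrite invK ?inE.
  rewrite -(esum_pred_image (mu \o uncurry G) _ xpredT) ?[fun=> _]set_true//.
  by rewrite image_eq.
rewrite (_ : esum _ _ = \sum_(i <oo) \sum_(j <oo ) mu (G i j)); last first.
  pose J : nat -> set (nat * nat) := fun i => [set (i, j) | j in setT].
  rewrite (_ : setT = \bigcup_k J k); last first.
    by rewrite predeqE => -[a b]; split => // _; exists a => //; exists b.
  rewrite esum_bigcupT /=; last 2 first.
    - apply/trivIsetP => i j _ _ ij.
      rewrite predeqE => -[k m] /=; split => //= -[] [_] _ [<-{k} _].
      by move=> [m' _] [] /esym/eqP; rewrite (negbTE ij).
    - by move=> /= [k m]; apply: mu_ge0.
  rewrite -(image_id [set: nat]) -fun_true esum_pred_image//; last first.
    by move=> k _; exact: esum_ge0.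
  apply: eq_eseriesr => /= j _.
  rewrite -(esum_pred_image (mu \o uncurry G) (pair j) predT)//=; last first.
    by move=> ? ? _ _; exact: (@can_inj _ _ _ snd).
  by congr esum; rewrite predeqE => -[a b]; split; move=> [i _ <-]; exists i.
apply: lee_lim.
- apply: is_cvg_nneseries => k *.
  by apply: nneseries_ge0 => m *; exact: (muG_ge0 (k, m)).
- by apply: is_cvg_nneseries => k *; apply: adde_ge0 => //; exact: cover_ext_ge0.
- by near=> k; apply: lee_sum => i _; exact: (PG i).2.
Unshelve. all: by end_near. Qed.

End cover_outer_measure.

Section euclidean.
Context {R : realType} {n : nat}.

(** Euclidean norm |x| (NB: mathcomp's `|x| on 'rV is the sup norm) *)
Definition enorm (x : 'rV[R]_n) : R := Num.sqrt (\sum_(i < n) (x ord0 i) ^+ 2).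

Definition eball (x : 'rV[R]_n) (r : R) : set 'rV[R]_n :=
  [set y | enorm (y - x) < r].

Definition ei (i : 'I_n) : 'rV[R]_n := delta_mx ord0 i.

Definition box (a b : 'rV[R]_n) : set 'rV[R]_n :=
  [set x | forall i, a ord0 i <= x ord0 i < b ord0 i].

Definition box_vol (a b : 'rV[R]_n) : R :=
  \prod_(i < n) Num.max (b ord0 i - a ord0 i) 0.

Definition boxes : set (set 'rV[R]_n) :=
  [set A | A = set0 \/ exists a b, A = box a b].

Definition elem_vol (A : set 'rV[R]_n) : \bar R :=
  ereal_inf [set x : \bar R | (A = set0 /\ x = 0%E) \/
                              exists a b, A = box a b /\ x = (box_vol a b)%:E].

Lemma boxes0 : boxes set0. Proof. by left. Qed.

Lemma elem_vol_ge0 A : (0 <= elem_vol A)%E.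
Proof.
apply: le_ereal_inf_tmp => x [[_ ->]//|[a [b [_ ->]]]].
by rewrite lee_fin; apply: prodr_ge0 => i _; rewrite le_max lexx orbT.
Qed.

Lemma elem_vol0 : elem_vol set0 = 0%E.
Proof.
apply/eqP; rewrite eq_le elem_vol_ge0 andbT.
by apply: ereal_inf_lbound; left.
Qed.

Definition leb_outer : set 'rV[R]_n -> \bar R := cover_ext boxes elem_vol.

HB.instance Definition _ := isOuterMeasure.Build R 'rV[R]_n leb_outer
  (cover_ext0 boxes0 elem_vol0 elem_vol_ge0)
  (cover_ext_ge0 boxes elem_vol_ge0)
  (@le_cover_ext _ _ boxes elem_vol)
  (cover_ext_sigma_subadditive boxes elem_vol_ge0).

End euclidean.
Arguments leb_outer : clear implicits.

Section function_spaces.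
Context {R : realType} {n : nat}.
Local Notation Rn := 'rV[R]_n.

Definition lebOM : {outer_measure set Rn -> \bar R} := leb_outer R n.
Definition Leb : measurableType _ := caratheodory_type lebOM.

(** Lebesgue measure V, as a measure on [Leb]; as a set function on all
    subsets of R^n it is the Lebesgue outer measure. *)
Definition V : {measure set Leb -> \bar R} :=
  (lebOM : set (caratheodory_type lebOM) -> \bar R).

Fixpoint Ck (k : nat) (f : Rn -> R) : Prop :=
  match k with
  | 0 => continuous f
  | k'.+1 => continuous f /\ (forall i x, derivable f x (ei i)) /\
             forall i, Ck k' (fun x => 'D_(ei i) f x)
  end.

Definition smooth (f : Rn -> R) : Prop := forall k, Ck k f.

Definition C0inf (f : Rn -> R) : Prop :=
  smooth f /\ compact (closure [set x | f x != 0]).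

Fixpoint diffk (k : nat) (h : Rn) (f : Rn -> R) : Rn -> R :=
  match k with
  | 0 => f
  | k'.+1 => fun x => diffk k' h f (x + h) - diffk k' h f x
  end.

Definition Lpnorm (p : R) (g : Rn -> R) : \bar R :=
  Lnorm V p%:E (fun x : Leb => (g x)%:E).

Definition besov_norm (beta p q : R) (f : Rn -> R) : \bar R :=
  poweR (\int[V]_h
           (poweR (Lpnorm p (diffk (Num.truncn beta).+1 h f)) q *
            (powR (enorm h) (- (n%:R + beta * q)))%:E)%E) q^-1.

Definition capK (beta p q : R) (K : set Rn) : \bar R :=
  ereal_inf [set poweR (besov_norm beta p q f) p |
              f in [set f | C0inf f /\ forall x, \1_K x <= f x]].

Definition cap (beta p q : R) (E : set Rn) : \bar R :=
  ereal_inf [set ereal_sup [set capK beta p q K |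
                             K in [set K | compact K /\ K `<=` O]] |
              O in [set O | open O /\ E `<=` O]].

(** Lorentz quasinorm ||g||_{L^{s,q0}(R^n; nu)}, with d(t^{q0}) written as
    q0 t^{q0-1} dt *)
Definition lorentz (nu : set Rn -> \bar R) (s q0 : R) (g : Rn -> R) : \bar R :=
  poweR (\int[lebesgue_measure]_(t in [set t : R | 0 < t])
           (poweR (nu [set x | (t < `|g x|)%R]) (q0 / s) *
            (q0 * powR t (q0 - 1))%:E)%E) q0^-1.

Definition bounded_domain (O : set Rn) : Prop :=
  [/\ open O, connected O, O !=set0 & exists M : R, forall x, O x -> enorm x <= M].

Definition smooth_boundary (O : set Rn) : Prop :=
  forall x, (closure O `\` O) x ->
    exists r : R, 0 < r /\ exists rho : Rn -> R,
      [/\ smooth rho, (exists i, 'D_(ei i) rho x != 0) &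
          O `&` eball x r = [set y | eball x r y /\ rho y < 0]].

End function_spaces.

(* Main.v *)
Require Import Defs.
From HB Require Import structures.
From mathcomp Require Import all_boot all_order all_algebra.
From mathcomp Require Import all_classical all_reals all_analysis.
From mathcomp Require Import measurable_realfun.
From mathcomp Require Import ring lra.
Import Order.TTheory GRing.Theory Num.Theory numFieldNormedType.Exports.
Local Open Scope classical_set_scope.
Local Open Scope ring_scope.

(* Both inequalities follow, for every [q > 0], from the weak-type embedding
     V {|f| >= 1} <= C * a ^ (np / (n - p beta))   whenever  ||f|| <= a
   for the Besov norm.  Put k = 1 + floor(beta) and let W_i be the volume of the
   level set {|f| >= 2^(-(k+1) i)}.  At every scale s, Markov's inequality gives
   ||Delta_h^k f||_p <= l s^beta a for at least half of the increments h of size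
   comparable to s.  If s is chosen so that l s^beta a is a small multiple of
   2^(-(k+1) i) W_i^(1/p), then for such h at least half of the points x of the
   i-th level set have Delta_h^k f(x) small, so that one of x + h, ..., x + k h
   lies in the next level set.  Tonelli's theorem turns this into
   W_(i+1) >= c s^n, that is
     W_(i+1) >= c' W_i^(n/(beta p)) (2^(-(k+1) i) / a)^(n/beta).
   As n/(beta p) > 1, the W_i would tend to infinity if W_0 exceeded the stated
   bound, whereas they are bounded by the volume of the support of f. *)

(** * Lebesgue outer measure of boxes *)

Section box_volume.
Context {R : realType} {n : nat}.
Implicit Types a b : 'rV[R]_n.

Let len (s t : R) : R := Num.max (t - s) 0.

Let len_ge0 s t : 0 <= len s t. Proof. by rewrite le_max lexx orbT. Qed.

(* The indicator of the box with its first [i] variables integrated out. *)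
Let mixed (i : nat) a b (x : 'I_n -> R) : R :=
  \prod_(j < n) (if (j < i)%N then len (a ord0 j) (b ord0 j)
                 else \1_(`[a ord0 j, b ord0 j[%classic) (x j)).

Let mixed_ge0 i a b x : 0 <= mixed i a b x.
Proof. by apply: prodr_ge0 => j _; case: ifP. Qed.

Let rest (i : 'I_n) a b (x : 'I_n -> R) : R :=
  \prod_(j < n | j != i) (if (j < i)%N then len (a ord0 j) (b ord0 j)
                 else \1_(`[a ord0 j, b ord0 j[%classic) (x j)).

Let rest_ge0 i a b x : 0 <= rest i a b x.
Proof. by apply: prodr_ge0 => j _; case: ifP. Qed.

Let upd (x : 'I_n -> R) (i : 'I_n) (t : R) : 'I_n -> R :=
  fun j => if j == i then t else x j.

Let mixed_upd (i : 'I_n) a b x t :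
  mixed i a b (upd x i t) =
  rest i a b x * \1_(`[a ord0 i, b ord0 i[%classic) t.
Proof.
rewrite /mixed (bigD1 i)//= ltnn /upd eqxx mulrC; congr (_ * _).
by apply: eq_bigr => j ji; rewrite (negbTE ji).
Qed.

Let mixedS (i : 'I_n) a b x :
  mixed i.+1 a b x = rest i a b x * len (a ord0 i) (b ord0 i).
Proof.
rewrite /mixed (bigD1 i)//= ltnSn mulrC; congr (_ * _).
by apply: eq_bigr => j ji; rewrite ltnS leq_eqVlt val_eqE (negbTE ji).
Qed.

(** Only the [i]-th factor depends on [t]; [rest] comes out of the integral and the indicator
    integrates to the side length. *)
Let mixed_integral (i : 'I_n) a b x :
  (\int[lebesgue_measure]_t (mixed i a b (upd x i t))%:E =
   (mixed i.+1 a b x)%:E)%E.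
Proof.
under eq_integral do rewrite mixed_upd EFinM.
rewrite ge0_integralZl//; last 2 first.
- exact/measurable_EFinP/measurable_indic.
- by rewrite lee_fin.
rewrite integral_indic//= setIT.
rewrite lebesgue_measure_itv/= lte_fin mixedS EFinM.
congr (_ * _)%E; rewrite /len; case: ltP => ab.
  by rewrite max_l// subr_ge0 ltW.
by rewrite max_r// subr_le0.
Qed.

Let mixed_measurable (i : 'I_n) a b x :
  measurable_fun setT (fun t : R => (mixed i a b (upd x i t))%:E).
Proof.
apply/measurable_EFinP; under eq_fun do rewrite mixed_upd.
exact: measurable_funM.
Qed.

Let mixed_box a b x : box a b (\row_j x j) -> mixed 0 a b x = 1.
Proof.
move=> xab; rewrite /mixed big1// => j _ /=; rewrite indicE mem_set//=.
by have := xab j; rewrite mxE in_itv.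
Qed.

Let mixed_notbox a b x : ~ box a b (\row_j x j) -> mixed 0 a b x = 0.
Proof.
move/existsNP => [j xab]; apply/eqP; rewrite prodf_seq_eq0/=.
apply/hasP; exists j; first by rewrite mem_index_enum.
rewrite /= indicE memNset//= in_itv/=.
by move: xab; rewrite mxE.
Qed.

(** Induction on the number [i] of integrated variables. For [i = 0] the claim compares indicators
    pointwise. Each further step integrates one variable, exchanging sum and integral by monotone
    convergence, until the indicators have become volumes. *)
Lemma box_vol_cover a b (a' b' : nat -> 'rV[R]_n) :
  box a b `<=` \bigcup_k box (a' k) (b' k) ->
  ((box_vol a b)%:E <= \sum_(k <oo) (box_vol (a' k) (b' k))%:E)%E.
Proof.
move=> cover.
have main i : (i <= n)%N -> forall x,
    ((mixed i a b x)%:E <= \sum_(k <oo) (mixed i (a' k) (b' k) x)%:E)%E.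
  elim: i => [_ x|i IH ilt x].
    have [xab|xab] := pselect (box a b (\row_j x j)); last first.
      by rewrite mixed_notbox// nneseries_ge0// => k _ _; rewrite lee_fin.
    have [k _ xk] := cover _ xab.
    rewrite mixed_box// (@nneseriesD1 _ _ k)//; last by move=> *; rewrite lee_fin.
    rewrite mixed_box// leeDl// nneseries_ge0// => j _ _.
    by rewrite lee_fin.
  pose o : 'I_n := Ordinal ilt.
  rewrite -(mixed_integral o).
  under eq_eseriesr => k _ do rewrite -(mixed_integral o).
  rewrite -integral_nneseries//; last 2 first.
  - by move=> k; exact: mixed_measurable.
  - by move=> k t _; rewrite lee_fin.
  apply: ge0_le_integral => //.
  - by move=> t _; rewrite lee_fin.
  - exact: mixed_measurable.
  - apply: (@ge0_emeasurable_sum _ _ _ _ _ xpredT) => [k t _ _|k _].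
      by rewrite lee_fin.
    exact: mixed_measurable.
  - by move=> t _; exact: (IH (ltnW ilt)).
(* With all [n] variables integrated out, [mixed] no longer depends on the point, so the zero
   function will do. *)
have := main n (leqnn n) (fun=> 0).
have E u v : mixed n u v (fun=> 0) = box_vol u v.
  by apply: eq_bigr => j _; rewrite ltn_ord.
by rewrite E; under eq_eseriesr => k _ do rewrite E.
Qed.

End box_volume.

(** * Outer measure of boxes, affine preimages and half-spaces *)

Section lebesgue_outer.
Context {R : realType} {n : nat}.
Local Notation Rn := 'rV[R]_n.+1.
Local Notation vol := (@leb_outer R n.+1).

(** Empty boxes pad finite covers to sequences. The dimension is [n.+1] because in dimension 0 no
    coordinate constrains the points of a box, which is then never empty. *)
Lemma box00 : box (0 : Rn) 0 = set0.
Proof.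
by apply/seteqP; split => // x /(_ ord0) /andP[/le_lt_trans] /[apply]; rewrite ltxx.
Qed.

Lemma box_vol00 : box_vol (0 : Rn) 0 = 0.
Proof. by rewrite /box_vol big_ord_recl mxE subrr maxxx mul0r. Qed.

Lemma box_vol_ge0 (a b : Rn) : 0 <= box_vol a b.
Proof. by apply: prodr_ge0 => i _; rewrite le_max lexx orbT. Qed.

Lemma box_vol_le (a b a' b' : Rn) :
  box a b `<=` box a' b' -> box_vol a b <= box_vol a' b'.
Proof.
move=> ab; pose c (k : nat) : Rn := if k is 0%N then a' else 0.
pose d (k : nat) : Rn := if k is 0%N then b' else 0.
have := @box_vol_cover R n.+1 a b c d.
rewrite (nneseries_split _ 1); last by move=> k _; rewrite lee_fin box_vol_ge0.
rewrite big_nat1 eseries0 ?adde0 ?lee_fin; last first.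
  by move=> [|k]// _ _; rewrite /= box_vol00.
by apply => x /ab xb; exists 0%N.
Qed.

(** Several pairs of corners may describe the same set, and [elem_vol] takes the infimum over all of
    them; by [box_vol_le] they all give the same volume. *)
Lemma elem_vol_box (A : set Rn) : boxes A ->
  exists a b, A = box a b /\ ((box_vol a b)%:E <= elem_vol A)%E.
Proof.
move=> bA; have [a [b Aab]] : exists a b, A = box a b.
  by case: bA => [->|//]; exists 0, 0; rewrite box00.
exists a, b; split=> //; apply: le_ereal_inf_tmp => x [[A0 ->]|[a' [b' [Aab' ->]]]].
  by rewrite lee_fin -box_vol00; apply: box_vol_le; rewrite -Aab A0.
by rewrite lee_fin; apply: box_vol_le; rewrite -Aab -Aab'.
Qed.

Lemma leb_outer_le (X : set Rn) (a b : nat -> Rn) :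
  X `<=` \bigcup_k box (a k) (b k) ->
  (vol X <= \sum_(k <oo) (box_vol (a k) (b k))%:E)%E.
Proof.
move=> Xab; apply: (@le_trans _ _ (\sum_(k <oo) elem_vol (box (a k) (b k)))%E).
  apply: ereal_inf_lbound; exists (fun k => box (a k) (b k)) => //.
  by split=> // k; right; exists (a k), (b k).
apply: lee_nneseries => [k _ _|k _]; first exact: elem_vol_ge0.
by apply: ereal_inf_lbound; right; exists (a k), (b k).
Qed.

(** Together with [leb_outer_le] this describes the outer measure by covers with explicit corners,
    which replaces [elem_vol] from here on. *)
Lemma leb_outer_ge (X : set Rn) y :
  (forall a b : nat -> Rn, X `<=` \bigcup_k box (a k) (b k) ->
     (y <= \sum_(k <oo) (box_vol (a k) (b k))%:E)%E) -> (y <= vol X)%E.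
Proof.
move=> yX; apply: le_ereal_inf_tmp => _ [F [bF XF] <-].
have [a /choice[b ab]] := choice (fun k => elem_vol_box _ (bF k)).
apply: (@le_trans _ _ (\sum_(k <oo) (box_vol (a k) (b k))%:E)%E).
  by apply: yX => x /XF[k _ Fx]; exists k => //; rewrite -(ab k).1.
by apply: lee_nneseries => [k _ _|k _]; [rewrite lee_fin box_vol_ge0|exact: (ab k).2].
Qed.

Lemma leb_outer_box (a b : Rn) : vol (box a b) = (box_vol a b)%:E.
Proof.
apply/eqP; rewrite eq_le; apply/andP; split; last first.
  by apply: leb_outer_ge => a' b'; exact: box_vol_cover.
pose c (k : nat) : Rn := if k is 0%N then a else 0.
pose d (k : nat) : Rn := if k is 0%N then b else 0.
have := @leb_outer_le (box a b) c d.
rewrite (nneseries_split _ 1); last by move=> k _; rewrite lee_fin box_vol_ge0.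
rewrite big_nat1 eseries0 ?adde0; last first.
  by move=> [|k]// _ _; rewrite /= box_vol00.
by apply => x xb; exists 0%N.
Qed.

(** A covering box pulls back under [h |-> x + h *+ j.+1] to a box whose sides are divided by
    [j.+1], hence no longer than before. *)
Lemma leb_outer_affine (A : set Rn) (x : Rn) (j : nat) :
  (vol [set h | A (x + h *+ j.+1)%R] <= vol A)%E.
Proof.
apply: leb_outer_ge => a b Aab.
have j0 : (0 : R) < j.+1%:R by rewrite ltr0n.
pose s (c : Rn) : Rn := \row_i ((c ord0 i - x ord0 i) / j.+1%:R).
apply: (@le_trans _ _ (\sum_(k <oo) (box_vol (s (a k)) (s (b k)))%:E)%E).
  apply: leb_outer_le => h /= /Aab[k _ hk]; exists k => // i.
  have := hk i; rewrite !mxE mulmxnE ler_pdivrMr// ltr_pdivlMr//.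
  by rewrite mulr_natr => /andP[? ?]; apply/andP; split; lra.
apply: lee_nneseries => [k _ _|k _]; rewrite lee_fin; first exact: box_vol_ge0.
apply: ler_prod => i _; rewrite le_max lexx orbT/= !mxE -mulrBl.
rewrite opprB addrA addrNK ge_max !le_max lexx !orbT andbT.
have [ab|ab] := leP (b k ord0 i) (a k ord0 i).
  by rewrite orbC mulr_le0_ge0 ?subr_le0// ltW// invr_gt0.
by rewrite ler_pdivrMr// ler_peMr ?subr_ge0 ?(ltW ab)// ler1n.
Qed.

Let set_coord (c : Rn) i (t : R) : Rn := \row_j (if j == i then t else c ord0 j).

(** The hyperplane cuts every covering box into two boxes whose volumes add up, so a cover of [X]
    splits into covers of its two pieces at no extra cost. *)
Lemma halfspace_caratheodory i (c : R) :
  caratheodory_measurable vol [set x : Rn | x ord0 i < c].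
Proof.
apply: le_caratheodory_measurable => X; apply: leb_outer_ge => a b Xab.
(* If a box lies on one side of the hyperplane, its other half has a nonpositive side, which
   [box_vol] truncates to 0. *)
pose b' k := set_coord (b k) i (Num.min (b k ord0 i) c).
pose a' k := set_coord (a k) i (Num.max (a k ord0 i) c).
have -> : (\sum_(k <oo) (box_vol (a k) (b k))%:E =
    \sum_(k <oo) (box_vol (a k) (b' k))%:E +
    \sum_(k <oo) (box_vol (a' k) (b k))%:E)%E.
  rewrite -nneseriesD; try by move=> k *; rewrite lee_fin box_vol_ge0.
  apply: eq_eseriesr => k _; rewrite -EFinD; congr (_%:E).
  rewrite /box_vol (bigD1 i)//= [in RHS](bigD1 i)//= [X in _ = _ + X](bigD1 i)//=.
  rewrite !mxE eqxx; set P := (X in _ * X = _).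
  rewrite [X in _ = _ * X + _](_ : _ = P); last first.
    by apply: eq_bigr => j ji; rewrite !mxE (negbTE ji).
  rewrite [X in _ = _ + _ * X](_ : _ = P); last first.
    by apply: eq_bigr => j ji; rewrite !mxE (negbTE ji).
  rewrite -mulrDl; congr (_ * _).
  have [bc|cb] := leP (b k ord0 i) c; have [ca|ac] := leP c (a k ord0 i);
    by rewrite /Num.max; do ![case: ltP => ?]; lra.
apply: leeD; apply: leb_outer_le => x.
  move=> [/Xab[k _ xk] /= xc]; exists k => // j; have := xk j; rewrite !mxE.
  by case: eqP => // ->; rewrite lt_min xc andbT.
move=> [/Xab[k _ xk] /= xc]; exists k => // j; have := xk j; rewrite !mxE.
case: eqP => // ->; rewrite ge_max => /andP[-> ->].
by rewrite leNgt; move/negP : xc => ->.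
Qed.

End lebesgue_outer.

(** * Lebesgue measurability *)

Section lebesgue_measurability.
Context {R : realType} {n : nat}.
Local Notation Rn := 'rV[R]_n.+1.
Local Notation L := (@Leb R n.+1).

Lemma measurable_coord i : measurable_fun setT (fun x : L => (x : Rn) ord0 i).
Proof.
move=> mD; apply: (measurability _ (RGenInftyO.measurableE R)) => //.
move=> /= _ [_ [c ->] <-]; rewrite setTI.
rewrite [X in measurable X](_ : _ = [set x : Rn | x ord0 i < c]).
  exact: halfspace_caratheodory.
by apply/seteqP; split => x /=; rewrite in_itv.
Qed.

Let ratbox (ab : 'rV[rat]_n.+1 * 'rV[rat]_n.+1) : set Rn :=
  box (map_mx ratr ab.1) (map_mx ratr ab.2).

(** Boxes with rational corners are countably many, so this reduces measurability of preimages of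
    open sets to measurability of coordinates. *)
Let open_ratbox (U : set Rn) : open U ->
  U = \bigcup_(ab in [set ab | ratbox ab `<=` U]) ratbox ab.
Proof.
move=> oU; apply/seteqP; split => [x Ux|x [ab /= + abx]]; last exact.
have /nbhs_ballP[e /= e0 xeU] : nbhs x U by exact: open_nbhs_nbhs.
have lex i : x ord0 i - e < x ord0 i by rewrite ltrBlDr ltrDl.
have ltx i : x ord0 i < x ord0 i + e by rewrite ltrDl.
have /choice[a ha] i := rat_in_itvoo (lex i).
have /choice[b hb] i := rat_in_itvoo (ltx i).
exists (\row_i a i, \row_i b i) => [y yab|i].
  apply: xeU; split => // i j; rewrite ord1 /ball/= ltr_norml.
  have := yab j; have := ha j; have := hb j; rewrite !mxE !in_itv/=.
  by move=> /andP[? ?] /andP[? ?] /andP[? ?]; apply/andP; split; lra.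
have := ha i; have := hb i; rewrite !mxE !in_itv/=.
by move=> /andP[? ?] /andP[? ?]; apply/andP; split; lra.
Qed.

Context {d : measure_display} {T : measurableType d}.

Lemma measurable_preimage_open (F : T -> Rn) (U : set Rn) :
  (forall i, measurable_fun setT (fun t => F t ord0 i)) -> open U ->
  measurable (F @^-1` U).
Proof.
move=> mF oU; rewrite (open_ratbox _ oU) preimage_bigcup bigcup_mkcond.
apply: countable_bigcupT_measurable => // ab; case: ifP => // _.
have -> : F @^-1` ratbox ab = \bigcap_(i in [set: 'I_n.+1])
    ((fun t => F t ord0 i) @^-1` `[ratr (ab.1 ord0 i), ratr (ab.2 ord0 i)[).
  apply/seteqP; split => t /=.
    by move=> h i _ /=; have := h i; rewrite !mxE in_itv.
  by move=> h i; have := h i Logic.I; rewrite /= !mxE in_itv.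
apply: fin_bigcap_measurable => // i _.
by rewrite -[X in measurable X]setTI; exact: mF.
Qed.

Lemma measurable_fun_continuous (F : T -> Rn) (f : Rn -> R) :
  (forall i, measurable_fun setT (fun t => F t ord0 i)) -> continuous f ->
  measurable_fun setT (f \o F).
Proof.
move=> mF cf mD; apply: (measurability _ (RGenOpens.measurableE R)) => //.
move=> /= _ [_ [a [b ->]] <-]; rewrite setTI comp_preimage.
apply: measurable_preimage_open => //.
by move/continuousP: cf; apply; exact: interval_open.
Qed.

End lebesgue_measurability.

Section lebesgue_measure_rV.
Context {R : realType} {n : nat}.
Local Notation Rn := 'rV[R]_n.+1.
Local Notation L := (@Leb R n.+1).

Lemma measurable_continuous (f : Rn -> R) : continuous f ->
  measurable_fun setT (f : L -> R).
Proof.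
move=> cf; apply: (@measurable_fun_continuous _ _ _ L id) => // i.
exact: measurable_coord.
Qed.

(** Joint measurability for the product of the two Lebesgue sigma-algebras, as Tonelli's theorem
    requires; it is checked coordinate by coordinate. *)
Lemma measurable_shift (f : Rn -> R) (j : nat) : continuous f ->
  measurable_fun setT (fun z : L * L => f ((z.1 : Rn) + (z.2 : Rn) *+ j)).
Proof.
move=> cf; pose F (z : L * L) : Rn := (z.1 : Rn) + (z.2 : Rn) *+ j.
apply: (@measurable_fun_continuous _ _ _ _ F) => // i.
rewrite (_ : (fun _ => _) =
  (fun z : L * L => (z.1 : Rn) ord0 i + j%:R * (z.2 : Rn) ord0 i)); last first.
  by apply/funext => z; rewrite /F !mxE mulmxnE mulr_natl.
apply: measurable_funD.
  exact: (measurableT_comp (measurable_coord i) measurable_fst).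
apply: measurable_funM => //.
exact: (measurableT_comp (measurable_coord i) measurable_snd).
Qed.

Lemma V_box_lty (a b : Rn) : (V (box a b : set L) < +oo)%E.
Proof. by rewrite /V/= [X in (X < _)%E]leb_outer_box ltry. Qed.

Lemma measurable_box (a b : Rn) : measurable (box a b : set L).
Proof.
have -> : box a b = \bigcap_(i in [set: 'I_n.+1])
    ((fun x : L => (x : Rn) ord0 i) @^-1` `[a ord0 i, b ord0 i[).
  apply/seteqP; split => t /=.
    by move=> h i _ /=; have := h i; rewrite in_itv.
  by move=> h i; have := h i Logic.I; rewrite /= in_itv.
apply: fin_bigcap_measurable => // i _.
by rewrite -[X in measurable X]setTI; exact: measurable_coord.
Qed.

Let cube (k : nat) : set Rn := box (const_mx (- k%:R)) (const_mx k%:R).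

Lemma V_sigma_finite : sigma_finite [set: L] V.
Proof.
exists cube; last by move=> k; split; [exact: measurable_box|exact: V_box_lty].
apply/esym; rewrite -subTset => x _.
have [k xk] : exists k : nat, forall i, `|x ord0 i| < k%:R.
  exists (\sum_i (Num.truncn `|x ord0 i|).+1)%N => i.
  apply: (@lt_le_trans _ _ (Num.truncn `|x ord0 i|).+1%:R).
    exact: truncnS_gt.
  by rewrite ler_nat (bigD1 i)//= leq_addr.
by exists k => // i; rewrite !mxE; have := xk i; rewrite ltr_norml => /andP[/ltW -> ->].
Qed.

Lemma V_bounded_lty (A : set Rn) : bounded_set A -> (V (A : set L) < +oo)%E.
Proof.
move=> [M [_ /(_ (M + 1))]]; rewrite ltrDl ltr01 => /(_ isT) AM.
(* Coordinates are bounded by [M + 1]; one more unit makes room for the open right ends of the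
   box. *)
apply: le_lt_trans (V_box_lty (const_mx (- (M + 2))) (const_mx (M + 2))).
apply: (le_outer_measure lebOM) => x /AM /= xM i; rewrite !mxE.
have : `|x ord0 i| <= M + 1.
  apply: le_trans xM; rewrite /Num.norm/= mx_normrE.
  by apply: (le_bigmax _ (fun ij => `|x ij.1 ij.2|) (ord0, i)).
by rewrite ler_norml => /andP[? ?]; apply/andP; split; lra.
Qed.

(** [V] bundled with its sigma-finiteness, the form in which the Tonelli theorems take a measure. *)
Definition Vsf : {sigma_finite_measure set L -> \bar R} :=
  HB.pack (Measure.sort V)
    (isSFinite.Build _ _ _ (Measure.sort V)
       (sfinite_measure_sigma_finite V_sigma_finite))
    (isSigmaFinite.Build _ _ _ (Measure.sort V) V_sigma_finite).

End lebesgue_measure_rV.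

(** * Finite differences and level sets *)

Section integral_monotonicity.
Local Open Scope ereal_scope.
Context d (T : measurableType d) (R : realType) (mu : {measure set T -> \bar R}).

(* The integral of a nonnegative function is a supremum over simple functions,
   so it is monotone even when the functions are not measurable. *)
Lemma ge0_le_integral_nomeas (D : set T) (f g : T -> \bar R) :
  (forall x, D x -> 0 <= f x) -> (forall x, D x -> f x <= g x) ->
  \int[mu]_(x in D) f x <= \int[mu]_(x in D) g x.
Proof.
move=> f0 fg; rewrite !(integral_mkcond D).
have f0D x : 0 <= (f \_ D) x by apply: erestrict_ge0.
have fgD x : (f \_ D) x <= (g \_ D) x.
  by rewrite !patchE; case: ifPn => // /set_mem /fg.
rewrite !ge0_integralTE//; last by move=> x; exact: le_trans (fgD x).
by apply: ereal_sup_le => _ /= [h hf <-]; exists h => // x; exact: le_trans (fgD x).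
Qed.

(** The function equal to [k] on [A] and 0 elsewhere lies below [g]; [ge0_le_integral_nomeas] then
    compares the integrals. *)
Lemma ge0_markov (A : set T) (k : R) (g : T -> \bar R) : measurable A ->
  (0 <= k)%R -> (forall x, 0 <= g x) -> (forall x, A x -> k%:E <= g x) ->
  k%:E * mu A <= \int[mu]_x g x.
Proof.
move=> mA k0 g0 kg; rewrite -integral_cst// integral_mkcond.
apply: ge0_le_integral_nomeas => x _; first by rewrite patchE; case: ifP.
by rewrite patchE; case: ifPn => // /set_mem; exact: kg.
Qed.

End integral_monotonicity.

Section finite_differences.
Context {R : realType} {n : nat}.
Local Notation Rn := 'rV[R]_n.
Implicit Types (f : Rn -> R) (h x : Rn).

Lemma diffk_le k h f x (t : R) :
  (forall j, (j <= k)%N -> `|f (x + h *+ j)| <= t) ->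
  `|diffk k h f x| <= 2 ^+ k * t.
Proof.
elim: k x => [|k IH] x ft /=.
  by rewrite expr0 mul1r; have := ft 0%N isT; rewrite mulr0n addr0.
have H1 : `|diffk k h f (x + h)| <= 2 ^+ k * t.
  by apply: IH => j jk; rewrite -addrA -mulrS; exact: ft.
have H2 : `|diffk k h f x| <= 2 ^+ k * t.
  by apply: IH => j jk; apply: ft; exact: leqW.
apply: le_trans (ler_normB _ _) _; rewrite exprS; lra.
Qed.

(** Up to sign, [f x] occurs once in the [k]-th difference; the other [2 ^+ k - 1] terms, counted
    with multiplicity, are values at [x + h], ..., [x + h *+ k]. *)
Lemma diffk_dominates k h f x (t : R) :
  (forall j, (0 < j <= k)%N -> `|f (x + h *+ j)| <= t) ->
  `|f x| <= `|diffk k h f x| + (2 ^+ k - 1) * t.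
Proof.
elim: k => [|k IH] ft /=.
  by rewrite expr0 subrr mul0r addr0.
have H1 : `|diffk k h f (x + h)| <= 2 ^+ k * t.
  by apply: diffk_le => j jk; rewrite -addrA -mulrS; exact: ft.
have H2 : `|f x| <= `|diffk k h f x| + (2 ^+ k - 1) * t.
  by apply: IH => j /andP[j0 jk]; apply: ft; rewrite j0 leqW.
have := lerB_dist (diffk k h f x) (diffk k h f (x + h)).
rewrite distrC exprS; lra.
Qed.

End finite_differences.

Section difference_measurability.
Context {R : realType} {n : nat}.
Local Notation Rn := 'rV[R]_n.+1.
Local Notation L := (@Leb R n.+1).
Local Notation V := (@V R n.+1).

(** The offset [j] serves the induction: [diffk k.+1] evaluates [diffk k] at a point shifted by
    [h]. *)
Lemma measurable_diffk (f : Rn -> R) k j : continuous f ->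
  measurable_fun setT
    (fun z : L * L => diffk k (z.2 : Rn) f ((z.1 : Rn) + (z.2 : Rn) *+ j)).
Proof.
move=> cf; elim: k j => [|k IH] j /=; first exact: measurable_shift.
apply: measurable_funB => //.
by under eq_fun do rewrite -addrA -mulrSr; exact: IH.
Qed.

(** Up to a power, the norm is a partial integral of a jointly measurable function, hence measurable
    in [h] by Tonelli's theorem. *)
Lemma measurable_Lpnorm_diffk (p : R) (f : Rn -> R) k : continuous f ->
  measurable_fun setT (fun h : L => Lpnorm p (diffk k h f)).
Proof.
move=> cf; rewrite /Lpnorm unlock.
apply: (measurableT_comp (measurable_poweR _)).
pose g (z : L * L) : \bar R := (`|(diffk k (z.2 : Rn) f (z.1 : Rn))%:E| `^ p)%E.
apply: (@measurable_fun_fubini_tonelli_G _ _ _ _ _ Vsf g) => [|z].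
  apply: (measurableT_comp (measurable_poweR _)).
  apply: measurableT_comp => //; apply/measurable_EFinP.
  by have := measurable_diffk f k 0 cf; under eq_fun do rewrite mulr0n addr0.
exact: poweR_ge0.
Qed.

Lemma V_sections (S : set (L * L)) : measurable S ->
  (\int[V]_x V (xsection S x) = \int[V]_y V (ysection S y))%E.
Proof.
move=> mS; have := indic_fubini_tonelli Vsf Vsf mS.
by rewrite indic_fubini_tonelli_FE// indic_fubini_tonelli_GE.
Qed.

Lemma V_le (A B : set Rn) : A `<=` B -> (V A <= V B)%E.
Proof. exact: (le_outer_measure lebOM). Qed.

End difference_measurability.

(** * Increments with small differences at a given scale *)

Section good_increments.
Context {R : realType} {n : nat}.
Local Notation Rn := 'rV[R]_n.+1.
Local Notation L := (@Leb R n.+1).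
Local Notation V := (@V R n.+1).

Lemma enorm_le (h : Rn) (t : R) : 0 <= t -> (forall i, `|h ord0 i| <= t) ->
  enorm h <= n.+1%:R * t.
Proof.
move=> t0 ht.
rewrite -[leRHS]ger0_norm ?mulr_ge0// -sqrtr_sqr ler_wsqrtr//.
apply: (@le_trans _ _ (\sum_(i < n.+1) t ^+ 2)).
  by apply: ler_sum => i _; rewrite -real_normK ?num_real// lerXn2r ?nnegrE.
rewrite sumr_const card_ord -[leLHS]mulr_natl exprMn.
apply: ler_wpM2r; rewrite ?sqr_ge0//.
by rewrite expr2 ler_peMl// ler1n.
Qed.

Lemma enorm_gt0 (h : Rn) i : h ord0 i != 0 -> 0 < enorm h.
Proof.
move=> hi; rewrite sqrtr_gt0 (bigD1 i)//= ltr_wpDr//.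
  by apply: sumr_ge0 => j _; exact: sqr_ge0.
by rewrite exprn_even_gt0.
Qed.

(* By Markov's inequality the Besov integral controls the integrand on at least
   half of the cube [s, 2s[^n, uniformly over the scale [s]. *)
Lemma good_increments (beta q : R) : 0 < beta -> 0 < q ->
  exists l : R, 0 < l /\ forall (N : L -> \bar R) (a s : R),
    measurable_fun setT N -> (forall h, 0 <= N h)%E -> 0 < a -> 0 < s ->
    (\int[V]_h (N h `^ q *
       (enorm (h : Rn) `^ (- (n.+1%:R + beta * q)))%:E) <= (a `^ q)%:E)%E ->
    exists G : set L, [/\ measurable G,
      forall h, G h -> (N h <= (l * s `^ beta * a)%:E)%E &
      ((s ^+ n.+1 / 2)%:E <= V G)%E].
Proof.
move=> beta0 q0; set e := n.+1%:R + beta * q.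
have e0 : 0 < e by rewrite addr_gt0// ?mulr_gt0.
(* By [enorm_le], [m * s] bounds the Euclidean norm on the cube with corners [s] and [2 * s]. *)
have [m m0 mE] : exists2 m : R, 0 < m & m = n.+1%:R * 2.
  by exists (n.+1%:R * 2) => //; rewrite mulr_gt0.
(* Chosen to make [kE] hold: the powers of [s] combine so that Markov's inequality leaves the bad
   set [B] at most half of the cube. *)
pose l := (2 * m `^ e) `^ q^-1.
have l0 : 0 < l by rewrite powR_gt0// mulr_gt0// powR_gt0.
exists l; split => // N a s mN N0 a0 s0 HN.
have sb0 : 0 < s `^ beta by rewrite powR_gt0.
pose y := l * s `^ beta * a.
have y0 : 0 < y by rewrite !mulr_gt0.
pose Q : set L := box (const_mx s : Rn) (const_mx (2 * s)).
pose B : set L := Q `&` [set h | (y%:E < N h)%E].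
have mQ : measurable Q by exact: measurable_box.
have mB : measurable B.
  by apply: emeasurable_fun_o_infty => //; exact: measurable_funTS.
have VQ : V Q = (s ^+ n.+1)%:E.
  rewrite /V/= [LHS]leb_outer_box/box_vol; congr (_%:E).
  rewrite (eq_bigr (fun=> s)) ?prodr_const ?card_ord// => i _.
  by rewrite !mxE max_l; lra.
have kE : y `^ q * (m * s) `^ (- e) = 2 * a `^ q / s ^+ n.+1.
  rewrite powRN !powRM ?powR_ge0 ?mulr_ge0 ?powR_ge0 ?ltW//.
  rewrite -[(_ `^ q^-1) `^ q]powRrM mulVf ?gt_eqF// powRr1 ?mulr_ge0 ?powR_ge0//.
  have -> : s `^ e = s ^+ n.+1 * (s `^ beta) `^ q.
    by rewrite -powRrM /e powRD ?powR_mulrn ?ltW// gt_eqF// implybT.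
  have m1 : m `^ e != 0 by rewrite gt_eqF// powR_gt0.
  have s1 : (s `^ beta) `^ q != 0 by rewrite gt_eqF// powR_gt0.
  have s2 : s ^+ n.+1 != 0 by rewrite expf_neq0// gt_eqF.
  by field; rewrite m1 s1 s2.
have VB : (V B <= (s ^+ n.+1 / 2)%:E)%E.
  have : ((y `^ q * (m * s) `^ (- e))%:E * V B <= (a `^ q)%:E)%E.
    apply: le_trans HN; apply: ge0_markov => //.
    - by rewrite mulr_ge0// powR_ge0.
    - by move=> h; rewrite mule_ge0 ?poweR_ge0// lee_fin powR_ge0.
    move=> h [Qh /= yN].
    rewrite EFinM; apply: lee_pmul; rewrite ?lee_fin ?powR_ge0//.
      rewrite -poweR_EFin gt0_ler_poweR ?(ltW q0) ?ltW//.
        by rewrite in_itv/= lee_fin ltW//= leey.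
      by rewrite in_itv/= N0 leey.
    have h0 : 0 < enorm (h : Rn).
      have := Qh ord0; rewrite !mxE => /andP[sh _].
      by apply: (@enorm_gt0 _ ord0); rewrite gt_eqF// (lt_le_trans s0).
    rewrite !powRN lef_pV2 ?posrE ?powR_gt0 ?mulr_gt0//.
    apply: ge0_ler_powR; rewrite ?nnegrE ?mulr_ge0 ?(ltW e0) ?(ltW h0)//;
      rewrite ?(ltW s0) ?(ltW m0)//.
    rewrite mE -mulrA; apply: enorm_le => [|i]; first by rewrite mulr_ge0// ltW.
    have := Qh i; rewrite !mxE => /andP[sh hs].
    by rewrite ger0_norm ?(ltW hs)// (le_trans (ltW s0)).
  rewrite kE -lee_pdivlMl; last by rewrite divr_gt0 ?exprn_gt0// mulr_gt0// powR_gt0.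
  move/le_trans; apply; rewrite -EFinM lee_fin.
  have aq : a `^ q != 0 by rewrite gt_eqF// powR_gt0.
  have : s ^+ n.+1 != 0 by rewrite expf_neq0// gt_eqF.
  by move=> sn; rewrite le_eqVlt; apply/orP; left; apply/eqP; field; rewrite aq sn.
exists (Q `\` B); split.
- exact: measurableD.
- by move=> h [Qh /not_andP[//|/negP]]; rewrite -leNgt.
have : (V Q <= V (Q `\` B) + V B)%E.
  apply: le_trans (outer_measureU2 lebOM _ _).
  by apply: V_le => h Qh; have [] := pselect (B h); [right|left].
rewrite VQ => QB; rewrite -(@leeD2rE _ (s ^+ n.+1 / 2)%:E)//.
apply: le_trans (leeD2l _ VB); apply: le_trans QB.
by rewrite -EFinD lee_fin -splitr.
Qed.

End good_increments.

Lemma measurable_norm_ge d (T : measurableType d) (R : realType) (g : T -> R)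
  (t : R) : measurable_fun setT g -> measurable [set x | t <= `|g x|].
Proof.
move=> mg; have mng := measurableT_comp (@normr_measurable R setT) mg.
have := mng measurableT _ (measurable_itv `[t, +oo[); rewrite setTI.
by congr measurable; apply/seteqP; split => x /=; rewrite in_itv/= andbT.
Qed.

Section level_sets.
Context {R : realType} {n : nat}.
Local Notation Rn := 'rV[R]_n.+1.
Local Notation L := (@Leb R n.+1).
Local Notation V := (@V R n.+1).

Definition level_set (f : Rn -> R) (t : R) : set Rn := [set x | t <= `|f x|].

Lemma measurable_level_set (f : Rn -> R) t : continuous f ->
  measurable (level_set f t : set L).
Proof.
by move=> cf; apply: measurable_norm_ge; exact: measurable_continuous.
Qed.

Lemma measurable_diffk1 (f : Rn -> R) k h : continuous f ->
  measurable_fun setT (fun x : L => diffk k h f x).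
Proof.
move=> cf; have := measurable_diffk f k 0 cf.
move/measurableT_comp => /(_ _ _ _ _ (pair2_measurable (h : L))).
by rewrite /comp/=; under eq_fun do rewrite mulr0n addr0.
Qed.

Lemma markov_diffk (f : Rn -> R) k (h : Rn) (p t y : R) : continuous f ->
  0 < p -> 0 < t -> (Lpnorm p (diffk k h f) <= y%:E)%E ->
  ((t `^ p)%:E * V (level_set (diffk k h f) t) <= (y `^ p)%:E)%E.
Proof.
move=> cf p0 t0 Ny; have y0 : 0 <= y by rewrite -lee_fin (le_trans _ Ny)// Lnorm_ge0.
apply: (@le_trans _ _ (Lpnorm p (diffk k h f) `^ p)%E).
  rewrite poweR_Lnorm ?gt_eqF//; apply: ge0_markov.
  - by apply: measurable_norm_ge; exact: measurable_diffk1.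
  - exact: powR_ge0.
  - by move=> x; exact: poweR_ge0.
  - move=> x; rewrite /level_set/= => tx; rewrite lee_fin.
    by apply: ge0_ler_powR; rewrite ?nnegrE ?(ltW p0) ?(ltW t0).
rewrite -poweR_EFin gt0_ler_poweR ?(ltW p0) ?in_itv/= ?Lnorm_ge0 ?leey//.
by rewrite lee_fin y0.
Qed.

(* Points of a level set can be shifted into a lower level set along most
   increments [h] in [G]; Tonelli turns this into a lower bound on its volume. *)
Lemma level_set_shift (f : Rn -> R) (k : nat) (G : set L) (p t y g w w' : R) :
  continuous f -> measurable G -> 0 < p -> 0 < t ->
  (forall h, G h -> (Lpnorm p (diffk k (h : Rn) f) <= y%:E)%E) ->
  (g%:E <= V G)%E -> 0 < w -> y `^ p <= w / 2 * (t / 2) `^ p ->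
  V (level_set f t) = w%:E -> V (level_set f (t / 2 ^+ k.+1)) = w'%:E ->
  g <= 2 * k%:R * w'.
Proof.
move=> cf mG p0 t0 NG gG w0 yw Ew Ew'.
set A := level_set f t; set A' := level_set f _ in Ew'.
(* Pairs [(x, h)] with [x] in the upper level set and one of [x + h], ..., [x + h *+ k] in the lower
   one. The total volume of its sections is estimated in both directions. *)
pose S : set (L * L) := (fst @^-1` A) `&`
  \bigcup_(j in `I_k) [set z : L * L | A' ((z.1 : Rn) + (z.2 : Rn) *+ j.+1)].
have mS : measurable S.
  apply: measurableI.
    rewrite -[X in measurable X]setTI; apply: measurable_fst => //.
    exact: measurable_level_set.
  apply: bigcup_measurable => j _; apply: measurable_norm_ge.
  exact: measurable_shift.
have w'0 : 0 <= w' by rewrite -lee_fin -Ew' measure_ge0.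
(* For fixed [x] the section is covered by [k] affine preimages of [A'], each of volume at most
   [w']. *)
have xS : (\int[V]_x V (xsection S x) <= ((k%:R * w') * w)%:E)%E.
  rewrite EFinM -Ew -integral_cst; last exact: measurable_level_set.
  rewrite [leRHS]integral_mkcond; apply: ge0_le_integral_nomeas => x _ //.
  rewrite patchE; case: ifPn => [_|/negP xA].
    pose F j : set Rn := [set h : Rn | A' ((x : Rn) + h *+ j.+1)].
    apply: (@le_trans _ _ (V (\big[setU/set0]_(j < k) F j))).
      apply: V_le => h /xsectionP[_ [j jk /= Ah]].
      by rewrite -(bigcup_mkord k F); exists j.
    apply: le_trans (outer_measure_subadditive lebOM _ _) _.
    apply: (@le_trans _ _ (\sum_(j < k) w'%:E)%E).
      by apply: lee_sum => j _; rewrite -Ew'; exact: leb_outer_affine.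
    by rewrite sumEFin lee_fin sumr_const card_ord mulr_natl.
  rewrite (_ : xsection S x = set0) ?measure0//.
  by apply/seteqP; split => // h /xsectionP[xA']; case: xA; rewrite inE.
(* For a good [h], Markov's inequality bounds by [w / 2] the volume where the difference reaches
   [t / 2]; the rest of [A] lies in the section. *)
have yS h : G h -> ((w / 2)%:E <= V (ysection S h))%E.
  move=> Gh; pose D := level_set (diffk k (h : Rn) f) (t / 2).
  have VD : (V D <= (w / 2)%:E)%E.
    have t2 : 0 < (t / 2) `^ p by rewrite powR_gt0 ?divr_gt0.
    rewrite -(@lee_pmul2l _ ((t / 2) `^ p)%:E)//.
    have /le_trans := markov_diffk _ _ _ _ _ _ cf p0 (divr_gt0 t0 (ltr0Sn R 1)) (NG _ Gh).
    by apply; rewrite -EFinM lee_fin mulrC.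
  have : (V A <= V (ysection S h) + V D)%E.
    apply: le_trans (outer_measureU2 lebOM _ _).
    apply: V_le => x Ax; have [xS'|xS'] := pselect (S (x, h)).
      by left; apply/ysectionP.
    right; rewrite /D /level_set/=.
    have small j : (0 < j <= k)%N -> `|f (x + (h : Rn) *+ j)| <= t / 2 ^+ k.+1.
      case: j => // j /= jk; rewrite leNgt; apply/negP => fj.
      apply: xS'; split => //; exists j => //=.
      by rewrite /A' /level_set/= ltW.
    have := diffk_dominates _ _ _ _ _ small.
    have : t <= `|f x| := Ax.
    (* This fixes the lower level [t / 2 ^+ k.+1]: the shifted values together contribute at most
       [t / 2], so the difference keeps the other half of [t]. *)
    have : (2 ^+ k - 1) * (t / 2 ^+ k.+1) <= t / 2.
      rewrite mulrA ler_pdivrMr ?exprn_gt0// exprS.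
      suff : 0 <= t by lra.
      exact: ltW.
    lra.
  rewrite Ew => AD; rewrite -(@leeD2rE _ (w / 2)%:E)//.
  apply: le_trans (leeD2l _ VD); apply: le_trans AD.
  by rewrite -EFinD lee_fin -splitr.
have : ((w / 2)%:E * V G <= ((k%:R * w') * w)%:E)%E.
  apply: le_trans xS; rewrite V_sections//.
  by apply: ge0_markov => //; rewrite divr_ge0// ltW.
have : ((w / 2)%:E * g%:E <= (w / 2)%:E * V G)%E.
  by apply: lee_wpmul2l => //; rewrite lee_fin divr_ge0 ?(ltW w0).
move=> /le_trans/[apply]; rewrite -EFinM lee_fin.
have -> : w / 2 * g = w * (g / 2) by ring.
rewrite [_ * w]mulrC ler_pM2l//; lra.
Qed.

End level_sets.

(** * Weak-type embedding *)

Section superlinear_growth.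
Context {R : realType}.

Lemma invr_powR (x g : R) : 0 <= x -> x^-1 `^ g = (x `^ g)^-1.
Proof. by move=> x0; rewrite -powR_inv1// -powRrM mulN1r powRN. Qed.

(** Bernoulli's inequality. *)
Let geometric_lower (r : R) i : 1 <= r -> 1 + i%:R * (r - 1) <= r ^+ i.
Proof.
move=> r1; elim: i => [|i IH]; first by rewrite mul0r addr0 expr0.
rewrite exprS -natr1; have : 0 <= i%:R * (r - 1) by rewrite mulr_ge0// subr_ge0.
nra.
Qed.

(** Otherwise [w i] would grow at least like [r ^+ i] with [r > 1], against the bound [M]. The ratio
    satisfies [r]^ (th - 1) = m [^ g], so the superlinear gain exactly offsets the decay of the
    levels. *)
Lemma superlinear_growth (w : nat -> R) (c g th m a M : R) :
  0 < c -> 0 < g -> 1 < th -> 1 < m -> 0 < a -> (forall i, w i <= M) ->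
  (forall i, 0 < w i -> c * (w i `^ th * ((m ^+ i)^-1 / a) `^ g) <= w i.+1) ->
  w 0%N <= (m `^ (g / (th - 1)) / c) `^ (th - 1)^-1 * a `^ (g / (th - 1)).
Proof.
move=> c0 g0 th1 m1 a0 wM wS; have th0 : 0 < th - 1 by rewrite subr_gt0.
have m0 : 0 < m by exact: lt_trans m1.
set r := m `^ (g / (th - 1)); set C := (r / c) `^ (th - 1)^-1.
have r1 : 1 < r.
  have := @gt0_ltr_powR R _ (divr_gt0 g0 th0) 1 m.
  by rewrite powR1; apply; rewrite // nnegrE ?ltW.
have r0 : 0 < r by exact: lt_trans r1.
have rc0 : 0 < r / c by rewrite divr_gt0.
have C0 : 0 < C by rewrite powR_gt0.
rewrite leNgt; apply/negP => w0C.
set w0 := w 0%N in w0C.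
have Ca0 : 0 < C * a `^ (g / (th - 1)) by rewrite mulr_gt0// powR_gt0.
have w00 : 0 < w0 by exact: lt_trans w0C.
(* The claimed bound solves [c * w]^ (th - 1) = r * a [^ g]; above it, the first step already gains
   a factor [r]. *)
have base : r * a `^ g <= c * w0 `^ (th - 1).
  rewrite -ler_pdivrMl//.
  have -> : c^-1 * (r * a `^ g) = (C * a `^ (g / (th - 1))) `^ (th - 1).
    rewrite powRM ?powR_ge0// -!powRrM mulVf ?gt_eqF// divfK ?gt_eqF//.
    by rewrite powRr1 ?(ltW rc0)// mulrA [c^-1 * r]mulrC.
  by apply: ge0_ler_powR; rewrite ?nnegrE ?(ltW th0) ?(ltW Ca0) ?(ltW w00) ?(ltW w0C).
have main i : w0 * r ^+ i <= w i.
  elim: i => [|i IH]; first by rewrite expr0 mulr1.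
  have wr0 : 0 < w0 * r ^+ i by rewrite mulr_gt0// exprn_gt0.
  apply: le_trans (wS i (lt_le_trans wr0 IH)).
  have mi : ((m ^+ i)^-1 / a) `^ g = ((m `^ g) ^+ i)^-1 / a `^ g.
    rewrite powRM ?invr_ge0 ?exprn_ge0 ?(ltW a0) ?(ltW m0)//.
    rewrite !invr_powR ?exprn_ge0 ?(ltW a0) ?(ltW m0)//; congr (_^-1 * _).
    by rewrite -powR_mulrn ?(ltW m0)// powRAC powR_mulrn ?powR_ge0.
  have rth : r `^ (th - 1) = m `^ g by rewrite -powRrM divfK// gt_eqF.
  have step : (w0 * r ^+ i) `^ th = w0 * r ^+ i * (w0 `^ (th - 1) * (m `^ g) ^+ i).
    rewrite -(mulr_powRB1 (ltW wr0)) ?(lt_trans _ th1)//; congr (_ * _).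
    rewrite powRM ?(ltW w00) ?exprn_ge0 ?(ltW r0)//; congr (_ * _).
    by rewrite -powR_mulrn ?(ltW r0)// powRAC rth powR_mulrn ?powR_ge0.
  apply: (@le_trans _ _ (c * ((w0 * r ^+ i) `^ th * ((m ^+ i)^-1 / a) `^ g))); last first.
    rewrite ler_pM2l// ler_wpM2r ?powR_ge0//.
    by apply: ge0_ler_powR => //; rewrite ?nnegrE ?ltW// ?(lt_trans _ th1)// (lt_le_trans wr0).
  rewrite mi step.
  have M0 : 0 < (m `^ g) ^+ i by rewrite exprn_gt0 ?powR_gt0.
  have A0 : 0 < a `^ g by rewrite powR_gt0.
  have -> : c * (w0 * r ^+ i * (w0 `^ (th - 1) * (m `^ g) ^+ i) * (((m `^ g) ^+ i)^-1 / a `^ g))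
      = w0 * r ^+ i * (c * w0 `^ (th - 1) / a `^ g).
    by field; rewrite !gt_eqF.
  by rewrite exprSr mulrA ler_pM2l// ler_pdivlMr.
(* With this many steps the Bernoulli lower bound exceeds [M]. *)
pose i := (Num.truncn (M / (w0 * (r - 1)))).+1.
have d0 : 0 < w0 * (r - 1) by rewrite mulr_gt0// subr_gt0.
have : M / (w0 * (r - 1)) < i%:R by exact: truncnS_gt.
rewrite ltr_pdivrMr// => Mi.
have gi : w0 * (1 + i%:R * (r - 1)) <= M.
  apply: le_trans (le_trans (main i) (wM i)).
  by rewrite ler_pM2l//; exact: geometric_lower (ltW r1).
suff : M < M by rewrite ltxx.
apply: lt_le_trans Mi _; apply: le_trans gi.
by rewrite [leRHS]mulrDr mulr1 [leLHS]mulrCA lerDr ltW.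
Qed.

End superlinear_growth.

Section weak_embedding.
Context {R : realType} {n : nat}.
Local Notation Rn := 'rV[R]_n.+1.
Local Notation L := (@Leb R n.+1).
Local Notation V := (@V R n.+1).

(* The scale [s] is chosen so that the L^p norm of the k-th difference at scale
   [s] accounts for at most half of the level set; see [level_set_shift]. *)
Lemma besov_weak_embedding (beta p q : R) :
  0 < beta -> 0 < q -> 0 < p -> p * beta < n.+1%:R ->
  exists C : R, 0 < C /\ forall (f : Rn -> R) (a : R),
    continuous f -> compact (closure [set x | f x != 0]) -> 0 < a ->
    (besov_norm beta p q f <= a%:E)%E ->
    (V (level_set f 1) <=
       (C * a `^ (n.+1%:R * p / (n.+1%:R - p * beta)))%:E)%E.
Proof.
move=> beta0 q0 p0 pbn.
have [l [l0 good]] := @good_increments R n _ _ beta0 q0.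
pose k := (Num.truncn beta).+1; pose m : R := 2 ^+ k.+1.
pose th : R := n.+1%:R / (beta * p); pose g : R := n.+1%:R / beta.
(* [level_set_shift] with volume [s ^+ n.+1 / 2] gives the [4 * k%:R]; the numerator is what remains
   of [s ^+ n.+1] once the powers of [w i] and [t / a] are split off. *)
pose c : R := 2^-1 `^ th * (2 * l)^-1 `^ g / (4 * k%:R).
have bp0 : 0 < beta * p by rewrite mulr_gt0.
have th1 : 1 < th by rewrite ltr_pdivlMr// mul1r mulrC.
have g0 : 0 < g by rewrite divr_gt0.
have k0 : (0 : R) < k%:R by rewrite ltr0n.
have c0 : 0 < c by rewrite divr_gt0 ?mulr_gt0 ?powR_gt0 ?invr_gt0 ?mulr_gt0.
have m1 : 1 < m by rewrite exprn_egt1// ltr1n.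
have m0 : 0 < m by exact: lt_trans m1.
exists ((m `^ (g / (th - 1)) / c) `^ (th - 1)^-1); split.
  by apply: powR_gt0; apply: divr_gt0 => //; exact: powR_gt0.
move=> f a cf csupp a0 fa.
pose supp : set Rn := closure [set x | f x != 0].
have Vsupp : (V supp < +oo)%E by apply: V_bounded_lty; exact: compact_bounded.
have Vlevel t : 0 < t -> (V (level_set f t) <= V supp)%E.
  move=> t0; apply: V_le => x; rewrite /level_set/= => tx.
  apply: subset_closure; rewrite /=; apply/eqP => fx0.
  by move: tx; rewrite fx0 normr0 leNgt t0.
have Vfin t : 0 < t -> V (level_set f t) = (fine (V (level_set f t)))%:E.
  by move=> t0; rewrite fineK// ge0_fin_numE ?measure_ge0// (le_lt_trans (Vlevel _ t0)).
have mi0 i : 0 < (m ^+ i)^-1 by rewrite invr_gt0 exprn_gt0.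
pose w i := fine (V (level_set f (m ^+ i)^-1)).
have wE i : V (level_set f (m ^+ i)^-1) = (w i)%:E by exact: Vfin.
have -> : V (level_set f 1) = (w 0%N)%:E by rewrite -wE expr0 invr1.
(* The exponent produced by the growth argument is the Sobolev exponent. *)
have -> : n.+1%:R * p / (n.+1%:R - p * beta) = g / (th - 1).
  have nbp : 1 + n%:R + -1 * (beta * p) != 0.
    by rewrite nat1r mulN1r gt_eqF// subr_gt0 mulrC.
  by rewrite /g /th; field; rewrite nbp !gt_eqF.
rewrite lee_fin; apply: (@superlinear_growth R w c g th m a (fine (V supp))) => //.
  move=> i; rewrite -lee_fin -wE fineK ?Vlevel// ge0_fin_numE//.
move=> i wi0; set t := (m ^+ i)^-1; have t0 : 0 < t := mi0 i.
have w20 : 0 < w i / 2 by rewrite divr_gt0.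
pose y := (w i / 2) `^ p^-1 * (t / 2).
have y0 : 0 < y by rewrite mulr_gt0 ?powR_gt0 ?divr_gt0.
have la0 : 0 < l * a by rewrite mulr_gt0.
pose s := (y / (l * a)) `^ beta^-1.
have s0 : 0 < s by rewrite powR_gt0// divr_gt0.
pose N (h : L) := Lpnorm p (diffk k (h : Rn) f).
have Na : (\int[V]_h (N h `^ q *
    (enorm (h : Rn) `^ (- (n.+1%:R + beta * q)))%:E) <= (a `^ q)%:E)%E.
  set I := integral _ _ _.
  have I0 : (0 <= I)%E.
    by apply: integral_ge0 => h _; rewrite mule_ge0 ?poweR_ge0// lee_fin powR_ge0.
  rewrite -(poweRe1 I0) -(mulVf (lt0r_neq0 q0)) poweRrM -poweR_EFin.
  by apply: gt0_ler_poweR fa; rewrite ?(ltW q0)// in_itv/= ?poweR_ge0 ?lee_fin ?(ltW a0) leey.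
have [G [mG GN VG]] := good N a s (measurable_Lpnorm_diffk p f k cf)
    (fun h => Lnorm_ge0 _ _ _) a0 s0 Na.
have sy : l * s `^ beta * a = y.
  rewrite -powRrM mulVf ?gt_eqF// powRr1 ?divr_ge0 ?(ltW y0) ?(ltW la0)//.
  by field; rewrite !gt_eqF.
have yp : y `^ p <= w i / 2 * (t / 2) `^ p.
  rewrite powRM ?powR_ge0 ?divr_ge0 ?(ltW t0)// -powRrM mulVf ?gt_eqF//.
  by rewrite powRr1 ?(ltW w20).
rewrite sy in GN.
have wS : V (level_set f (t / 2 ^+ k.+1)) = (w i.+1)%:E.
  have -> : t / 2 ^+ k.+1 = (m ^+ i.+1)^-1.
    by rewrite (exprSr m i) (invfM (m ^+ i) m).
  exact: wE.
have := level_set_shift _ _ _ _ _ _ _ _ _ cf mG p0 t0 GN VG wi0 yp (wE i) wS.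
have -> : s ^+ n.+1 = w i `^ th * (t / a) `^ g * (2^-1 `^ th * (2 * l)^-1 `^ g).
  rewrite -powR_mulrn ?(ltW s0)// -powRrM [_ * n.+1%:R]mulrC -/g.
  have -> : y / (l * a) = (w i / 2) `^ p^-1 * ((t / a) * (2 * l)^-1).
    by rewrite /y; field; rewrite !gt_eqF.
  rewrite powRM ?powR_ge0 ?mulr_ge0 ?invr_ge0 ?mulr_ge0 ?(ltW t0)
    ?(ltW a0) ?(ltW l0) ?exprn_ge0 ?(ltW m0)//.
  rewrite [(t / a * _) `^ g]powRM ?mulr_ge0 ?invr_ge0 ?mulr_ge0 ?(ltW t0)
    ?(ltW a0) ?(ltW l0) ?exprn_ge0 ?(ltW m0)//.
  rewrite -powRrM (_ : p^-1 * g = th); last by rewrite /g /th; field; rewrite !gt_eqF.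
  by rewrite powRM ?(ltW wi0)// mulrACA.
set P := w i `^ th * _; set K := 2^-1 `^ th * _.
rewrite /c -/K => h.
have -> : K / (4 * k%:R) * P = P * K / 2 / (2 * k%:R) by field; rewrite gt_eqF.
by rewrite ler_pdivrMr ?mulr_gt0// [leRHS]mulrC.
Qed.

End weak_embedding.

(** * Capacity inequalities *)

Section capacity.
Context {R : realType} {n : nat}.
Local Notation Rn := 'rV[R]_n.+1.
Local Notation L := (@Leb R n.+1).
Local Notation V := (@V R n.+1).
Context {beta p q : R}.
Context (beta0 : 0 < beta) (q0 : 0 < q) (p0 : 0 < p).
Context (pbn : p * beta < n.+1%:R).
Let e := (n.+1%:R - p * beta) / n.+1%:R.

Let e0 : 0 < e. Proof. by rewrite divr_gt0// subr_gt0. Qed.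

Lemma cap_ge0 (E : set Rn) : (0 <= cap beta p q E)%E.
Proof.
apply: le_ereal_inf_tmp => _ [U _ <-]; apply: le_ereal_sup_tmp.
(* The empty set keeps the supremum from being taken over an empty family. *)
exists (capK beta p q (set0 : set Rn)).
  by exists set0 => //; split; [exact: compact0|exact: sub0set].
by apply: le_ereal_inf_tmp => _ [g _ <-]; exact: poweR_ge0.
Qed.

(** An admissible [f] is at least 1 on [K], so the weak embedding bounds [V K]; the power [e] turns
    the Sobolev exponent into [p]. *)
Lemma isocapacitary_compact : exists c : R, 0 < c /\
  forall K : set Rn, (V K `^ e <= c%:E * capK beta p q K)%E.
Proof.
have [C [C0 HC]] := @besov_weak_embedding R n _ _ _ beta0 q0 p0 pbn.
pose ps : R := n.+1%:R * p / (n.+1%:R - p * beta); rewrite -/ps in HC.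
have ps0 : 0 < ps by rewrite divr_gt0 ?mulr_gt0// subr_gt0.
have pse : ps * e = p.
  have nbp : 1 + n%:R - p * beta != 0.
    by rewrite nat1r gt_eqF// subr_gt0.
  have n0 : 1 + n%:R != 0 :> R by rewrite nat1r.
  by rewrite /ps /e; field; rewrite nbp n0.
have Ce0 : 0 < C `^ e by rewrite powR_gt0.
exists (C `^ e); split => // K.
rewrite -lee_pdivrMl//; apply: le_ereal_inf_tmp => _ [f [[sf cf] fK] <-].
have b0 : (0 <= besov_norm beta p q f)%E by exact: poweR_ge0.
have contf : continuous f := sf 0%N.
have KV : (V K <= V (level_set f 1))%E.
  apply: V_le => x Kx; rewrite /level_set/=; apply: le_trans (ler_norm _).
  by have := fK x; rewrite indicE mem_set.
case bE : (besov_norm beta p q f) b0 => [r| |] b0 //; last first.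
  by rewrite poweRyr ?gt_eqF// leey.
rewrite lee_fin in b0.
have VK : (V K <= (C * r `^ ps)%:E)%E.
  move: b0; rewrite le_eqVlt => /orP[/eqP r0|r0]; last first.
    by apply: le_trans KV _; apply: HC => //; rewrite bE.
  (* The embedding asks for [0 < a]. When the norm vanishes it is applied with the [a] for which the
     bound equals an arbitrary [d > 0]. *)
  rewrite -r0 powR0 ?gt_eqF// mulr0; apply/lee_addgt0Pr => d d0; rewrite add0e.
  apply: le_trans KV _.
  have aE : C * ((d / C) `^ ps^-1) `^ ps = d.
    rewrite -powRrM mulVf ?gt_eqF// powRr1 ?divr_ge0 ?(ltW d0) ?(ltW C0)//.
    by rewrite mulrC divfK ?gt_eqF.
  rewrite -[leRHS]/(d%:E) -[in leRHS]aE; apply: HC => //.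
    by rewrite powR_gt0 ?divr_gt0.
  by rewrite bE -r0 lee_fin powR_ge0.
rewrite lee_pdivrMl// poweR_EFin -EFinM -pse powRrM -powRM ?powR_ge0 ?(ltW C0)//.
rewrite -poweR_EFin; apply: gt0_ler_poweR VK; rewrite ?(ltW e0)// in_itv/= leey andbT.
  exact: outer_measure_ge0.
by rewrite lee_fin mulr_ge0 ?powR_ge0 ?(ltW C0).
Qed.

Lemma compact_level_set (f : Rn -> R) (t : R) : C0inf f -> 0 < t ->
  compact (level_set f t).
Proof.
move=> [sf cf] t0; apply: subclosed_compact cf _.
  rewrite (_ : level_set f t = (fun x => `|f x|) @^-1` [set y | t <= y])//.
  apply: closed_comp => [x _|]; last exact: closed_ge.
  by apply: continuous_comp; [exact: (sf 0%N)|exact: norm_continuous].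
move=> x; rewrite /level_set/= => tx; apply: subset_closure; apply/eqP => fx0.
by move: tx; rewrite fx0 normr0 leNgt t0.
Qed.

(** The compact sets where [|f|] is at least [t + m.+1%:R^-1] exhaust the open superlevel set and
    lie in each of its open neighbourhoods, so continuity of [V] from below carries the bound
    over. *)
Lemma isocapacitary_superlevel (c : R) : 0 < c ->
  (forall K : set Rn, (V K `^ e <= c%:E * capK beta p q K)%E) ->
  forall (f : Rn -> R) (t : R), C0inf f -> 0 < t ->
  (V [set x | (t < `|f x|)%R] `^ e <= c%:E * cap beta p q [set x | (t < `|f x|)%R])%E.
Proof.
move=> c0 iso f t Cf t0; have contf : continuous f by exact: (Cf.1 0%N).
set Ot := [set x | _]; rewrite -lee_pdivrMl//.
apply: le_ereal_inf_tmp => _ [U [oU OtU] <-]; set Z := ereal_sup _.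
pose tm (m : nat) := t + m.+1%:R^-1.
pose K (m : nat) : set Rn := level_set f (tm m).
have tm0 m : 0 < tm m by rewrite addr_gt0// invr_gt0.
have KZ m : (V (K m) `^ e <= c%:E * Z)%E.
  apply: le_trans (iso _) _; apply: lee_wpmul2l; first by rewrite lee_fin ltW.
  apply: ereal_sup_ubound; exists (K m) => //; split; first exact: compact_level_set.
  apply: subset_trans OtU => x; rewrite /K /level_set/= => /(lt_le_trans _); apply.
  by rewrite ltrDl invr_gt0.
have Z0 : (0 <= c%:E * Z)%E by exact: le_trans (poweR_ge0 _ _) (KZ 0%N).
have e1 : e^-1 != 0 by rewrite invr_eq0 gt_eqF.
(* Moving the power to the right-hand side lets the limit be taken in [V] itself. *)
have KZ' m : (V (K m) <= (c%:E * Z) `^ e^-1)%E.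
  have V0 : (0 <= V (K m))%E by exact: measure_ge0.
  rewrite -[leLHS](poweRe1 V0) -(mulfV (lt0r_neq0 e0)) poweRrM.
  by apply: gt0_ler_poweR (KZ m); rewrite ?invr_ge0 ?(ltW e0)// in_itv/= ?Z0 ?poweR_ge0 leey.
have OtE : Ot = \bigcup_m K m.
  apply/seteqP; split => [x /= tx|x [m _]]; last first.
    by rewrite /K /level_set/=; apply: lt_le_trans; rewrite ltrDl invr_gt0.
  have d0 : 0 < `|f x| - t by rewrite subr_gt0.
  exists (Num.truncn (`|f x| - t)^-1) => //; rewrite /K /level_set/= /tm -lerBrDl.
  by rewrite -[leRHS]invrK lef_pV2 ?posrE ?invr_gt0// ltW// truncnS_gt.
have VOt : (V Ot <= (c%:E * Z) `^ e^-1)%E.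
  have mK m : measurable (K m : set L) by exact: measurable_level_set.
  have cvK : (V \o K) x @[x --> \oo] --> V Ot.
    rewrite OtE; apply: nondecreasing_cvg_mu => //; first exact: bigcup_measurable.
    move=> a b ab; apply/subsetPset => x; rewrite /K /level_set/=; apply: le_trans.
    by rewrite lerD2l lef_pV2 ?posrE// ler_nat.
  rewrite -(cvg_lim _ cvK)//; apply: lime_le; first by apply/cvg_ex; exists (V Ot).
  by apply: nearW => m; exact: KZ'.
rewrite lee_pdivrMl// -[leRHS](poweRe1 Z0) -(mulVf (lt0r_neq0 e0)) [leRHS]poweRrM.
apply: gt0_ler_poweR VOt; rewrite ?(ltW e0)// in_itv/= leey ?poweR_ge0//.
by rewrite andbT; exact: outer_measure_ge0.
Qed.

End capacity.

(** * Scaling of integrals and the Lorentz inequality *)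

Section integral_scaling.
Import HBNNSimple.

(** A simple function below [k f], divided by [k], lies below [f]. Arguing on simple functions
    covers the capacity of level sets as a function of [t] without a separate measurability
    proof. *)
Lemma ge0_integralZl_le d (T : measurableType d) (R : realType)
    (mu : {measure set T -> \bar R}) (D : set T) (k : R) (f : T -> \bar R) :
  0 < k -> (forall x, D x -> (0 <= f x)%E) ->
  (\int[mu]_(x in D) (k%:E * f x) <= k%:E * \int[mu]_(x in D) f x)%E.
Proof.
move=> k0 f0; rewrite !(integral_mkcond D).
rewrite (_ : _ \_ D = fun x => k%:E * (f \_ D) x)%E; last first.
  by apply/funext => x; rewrite !patchE; case: ifP; rewrite ?mule0.
have fD0 x : (0 <= (f \_ D) x)%E by apply: erestrict_ge0.
rewrite [leLHS]ge0_integralTE; last by move=> x; rewrite mule_ge0// lee_fin ltW.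
apply: ge_ereal_sup => _ /= [h hf <-].
rewrite -integralT_nnsfun -lee_pdivrMl// -ge0_integralZl//.
- apply: ge0_le_integral_nomeas => x _; last by rewrite lee_pdivrMl.
  by rewrite mule_ge0 ?lee_fin ?invr_ge0 ?(ltW k0) ?fun_ge0.
- exact/measurable_EFinP.
- by move=> x _; rewrite lee_fin.
- by rewrite lee_fin invr_ge0 ltW.
Qed.

End integral_scaling.

Theorem theorem4p2 (R : realType) (n : nat) (beta p q q0 : R) :
  0 < beta -> beta < n%:R -> 0 < q -> 1 <= p -> p < n%:R / beta -> 0 < q0 ->
  let P1 := exists c : R, 0 < c /\
      forall f : 'rV[R]_n -> R, C0inf f ->
        (lorentz (V : set 'rV[R]_n -> \bar R)
                 (n%:R * p / (n%:R - p * beta)) q0 f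
         <= c%:E * lorentz (cap beta p q) p q0 f)%E in
  let P2 := exists c : R, 0 < c /\
      forall O : set 'rV[R]_n, bounded_domain O -> smooth_boundary O ->
        (poweR (V O) ((n%:R - p * beta) / n%:R)
         <= c%:E * capK beta p q (closure O))%E in
  (P1 <-> P2) /\ (p <= q -> P1 /\ P2).
Proof.
(* In dimension 0 the bounds on [beta] contradict each other. *)
case: n => [|n] beta0 betan q_gt0 p1 pn q00 P1 P2.
  by have := lt_trans beta0 betan; rewrite ltxx.
have p0 : 0 < p by exact: lt_le_trans p1.
have pbn : p * beta < n.+1%:R by rewrite -ltr_pdivlMr.
suff [H1 H2] : P1 /\ P2 by split.
have [c [c0 iso]] := @isocapacitary_compact R n beta p q beta0 q_gt0 p0 pbn.
split; last first.
  exists c; split => // U _ _; apply: le_trans (iso (closure U)).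
  apply: gt0_ler_poweR; rewrite ?in_itv/= ?leey ?andbT; last first.
  - by apply: V_le; exact: subset_closure.
  - exact: outer_measure_ge0.
  - exact: outer_measure_ge0.
  - by rewrite divr_ge0// subr_ge0 ltW.
have cq0 : 0 < c `^ (q0 / p) by rewrite powR_gt0.
exists ((c `^ (q0 / p)) `^ q0^-1); split; first by rewrite powR_gt0.
move=> f Cf; rewrite /lorentz.
have cap0 t : (0 <= cap beta p q [set x | (t < `|f x|)%R])%E by exact: cap_ge0.
have w0 t : (0 <= (q0 * t `^ (q0 - 1))%:E :> \bar R)%E.
  by rewrite lee_fin mulr_ge0 ?powR_ge0 ?ltW.
set IV := integral _ _ _; set IC := (X in (_ <= _ * X `^ _)%E).
have IC0 : (0 <= IC)%E.
  by apply: integral_ge0 => t _; rewrite mule_ge0 ?poweR_ge0.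
have IV0 : (0 <= IV)%E.
  by apply: integral_ge0 => t _; rewrite mule_ge0 ?poweR_ge0.
have IVC : (IV <= (c `^ (q0 / p))%:E * IC)%E.
  (* The integrands are compared at each level [t]: the isocapacitary bound is raised to the power
     [q0 / p]. *)
  apply: (@le_trans _ _ (\int[lebesgue_measure]_(t in [set t : R | (0 < t)%R])
      ((c `^ (q0 / p))%:E * (cap beta p q [set x | (t < `|f x|)%R] `^ (q0 / p) *
        (q0 * t `^ (q0 - 1))%:E)))%E).
    apply: ge0_le_integral_nomeas => t /= t0; first by rewrite mule_ge0 ?poweR_ge0.
    rewrite muleA; apply: lee_wpmul2r => //.
    rewrite -poweR_EFin -poweRM// ?lee_fin ?(ltW c0)//.
    have -> : q0 / (n.+1%:R * p / (n.+1%:R - p * beta)) =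
        (n.+1%:R - p * beta) / n.+1%:R * (q0 / p).
      have nbp : 1 + n%:R - p * beta != 0.
        by rewrite nat1r gt_eqF// subr_gt0.
      have n0 : 1 + n%:R != 0 :> R by rewrite nat1r.
      by field; rewrite nbp n0 gt_eqF.
    rewrite [leLHS]poweRrM; apply: gt0_ler_poweR.
    - by rewrite divr_ge0 ?(ltW q00) ?(ltW p0).
    - by rewrite in_itv/= poweR_ge0 leey.
    - by rewrite in_itv/= mule_ge0 ?leey// lee_fin ltW.
    - exact: isocapacitary_superlevel.
  by apply: ge0_integralZl_le => // t _; rewrite mule_ge0 ?poweR_ge0.
rewrite -poweR_EFin -poweRM// ?lee_fin ?powR_ge0//.
apply: gt0_ler_poweR IVC; rewrite ?invr_ge0 ?(ltW q00)// in_itv/= leey andbT//.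
by rewrite mule_ge0// lee_fin powR_ge0.
Qed.
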